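(* Let $M\subseteq P^m$, $P=\Bbbk[x_1,\dots,x_n]$, be a quasi-stable (monomial) submodule with monomial Pommaret basis $H$. Then the syzygy resolution $$0\longrightarrow P^{r_{n-d}}\longrightarrow\cdots\longrightarrow P^{r_1}\longrightarrow P^{r_0}\longrightarrow M\longrightarrow0$$ induced by $H$ is minimal if and only if $M$ is stable.
   Context: $\Bbbk$ is a field. The class of $\mu\in\mathbb{N}_0^n$ is $\mathrm{cls}\,\mu=\min\{i\mid\mu_i\ne0\}$, $\mathrm{cls}\,0=n$; the class of a term $x^\mu e_\alpha\in P^m$ is $\mathrm{cls}\,\mu$, and its Pommaret cone is $\{x^{\mu+\rho}e_\alpha\mid\rho_j=0\ \forall j>\mathrm{cls}\,\mu\}$. For a term order on a free module, the class $\mathrm{cls}\,f$ of an element is that of its leading term, and a Pommaret basis of a submodule $N$ is a finite set of non-zero elements of $N$ with distinct leading terms whose Pommaret cones disjointly decompose the set of leading terms of $N$. A monomial submodule $M\subseteq P^m$ is quasi-stable if it has a finite Pommaret basis; $H=\{h_1,\dots,h_p\}$ denotes its (unique) Pommaret basis consisting of terms, and $d=\min_\alpha\mathrm{cls}\,h_\alpha$. Stability: a set $N\subseteq\mathbb{N}_0^n$ is stable if for each $\nu\in N$ all multi indices $\nu-1_k+1_j$ with $k=\mathrm{cls}\,\nu<j\le n$ are also in $N$ ($1_i$ is the $i$th unit vector). A monomial submodule $M$ is stable if each of the sets $\{\mu\mid x^\mu e_\alpha\in M\}$, $1\le\alpha\le m$, is stable. The syzygy resolution: Pommaret bases are always numbered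 by a $P$-ordering: $\alpha<\beta$ if $\mathrm{cls}\,h_\alpha<\mathrm{cls}\,h_\beta$, or if the classes are equal and the last non-vanishing entry of the difference of the leading exponents of $h_\alpha$ and $h_\beta$ is negative. Put $S_{\alpha;\emptyset}=h_\alpha$. Inductively, a Pommaret basis of the $i$th syzygy module is given by elements $S_{\alpha;\mathbf{k}}$, indexed by $\alpha$ and $\mathbf{k}=(k_1,\dots,k_i)$ with $\mathrm{cls}\,h_\alpha<k_1<\dots<k_i\le n$, with $\mathrm{cls}\,S_{\alpha;\mathbf{k}}=k_i$ for $i\ge1$. For $\mathrm{cls}\,S_{\alpha;\mathbf{k}}<k_{i+1}\le n$ there are unique polynomials with $x_{k_{i+1}}S_{\alpha;\mathbf{k}}=\sum_{\beta,\boldsymbol{\ell}}P^{(\alpha;\mathbf{k},k_{i+1})}_{\beta;\boldsymbol{\ell}}S_{\beta;\boldsymbol{\ell}}$, where $P^{(\alpha;\mathbf{k},k_{i+1})}_{\beta;\boldsymbol{\ell}}\in\Bbbk[x_1,\dots,x_{\mathrm{cls}\,S_{\beta;\boldsymbol{\ell}}}]$, and $S_{\alpha;\mathbf{k},k_{i+1}}=x_{k_{i+1}}e_{\alpha;\mathbf{k}}-\sum_{\beta,\boldsymbol{\ell}}P^{(\alpha;\mathbf{k},k_{i+1})}_{\beta;\boldsymbol{\ell}}e_{\beta;\boldsymbol{\ell}}$. These elements form a Pommaret basis of the next syzygy module with leading terms $x_{k_{i+1}}e_{\alpha;\mathbf{k}}$, for the Schreyer order $\prec_G$ induced by the preceding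 basis $G=\{g_1,g_2,\dots\}$ with its order $\prec$: $s\,e_\sigma\prec_Gt\,e_\tau$ iff $\mathrm{lt}_\prec(sg_\sigma)\prec\mathrm{lt}_\prec(tg_\tau)$, or these leading terms coincide and $\tau<\sigma$. In the resolution, $P^{r_i}$ is the free module with basis $\{e_{\alpha;\mathbf{k}}\mid\mathrm{cls}\,h_\alpha<k_1<\dots<k_i\le n\}$, and the maps are given by $e_{\alpha;\mathbf{k}}\mapsto S_{\alpha;\mathbf{k}}$ (with $e_{\alpha;\emptyset}\mapsto h_\alpha$). The resolution is minimal if no non-zero constant entries appear in the matrices of the maps $P^{r_i}\to P^{r_{i-1}}$, $i\ge1$. *)

(* Defs.v *)
From HB Require Import structures.
From mathcomp Require Import all_boot all_order all_algebra.
From mathcomp Require Import mpoly.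
From Stdlib Require Import ClassicalEpsilon.

Set Implicit Arguments.
Unset Strict Implicit.
Unset Printing Implicit Defensive.
Import GRing.Theory.
Local Open Scope ring_scope.

(* The ordinal [j : 'I_n] stands for the variable x_(j+1), whereas classes are
   natural numbers counted from 1 as in x_1, .., x_n; hence "j <= c" for a
   variable and a class reads [j.+1 <= c] below. *)

(* The base value n is the class of the zero multi index. *)
Definition cls n (mu : 'X_{1..n}) : nat :=
  \big[minn/n]_(j < n | mu j != 0%N) j.+1.

(* x^mu only involves x_1, .., x_c *)
Definition upto n (c : nat) (mu : 'X_{1..n}) : Prop :=
  forall j : 'I_n, (c < j.+1)%N -> mu j = 0%N.

(* The free K[x_1, .., x_n]-module with basis B; [^o] is the polynomial ring
   seen as a module over itself. *)
Notation freemod K n B := {ffun B -> {mpoly K[n]}^o}.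

(* (mu, b) encodes the term x^mu e_b, which is [mterm K (mu, b)] in the free
   module. *)
Notation term n B := ('X_{1..n} * B)%type.

Definition mterm (K : fieldType) (n : nat) (B : finType) (t : term n B) :
    freemod K n B :=
  [ffun b => if b == t.2 then 'X_[t.1] else 0].

Arguments mterm K {n B} t.

Definition term_supp (K : fieldType) (n : nat) (B : finType)
    (f : freemod K n B) : seq (term n B) :=
  [seq (mu, b) | b <- enum B, mu <- msupp (f b : {mpoly K[n]})].

(* [prec] is the strict order. *)
Definition term_order (n : nat) (B : finType) (prec : rel (term n B)) : Prop :=
  [/\ irreflexive prec,
      transitive prec,
      forall s t, s != t -> prec s t || prec t s,
      forall (rho : 'X_{1..n}) (s t : term n B),
        prec s t -> prec ((rho + s.1)%MM, s.2) ((rho + t.1)%MM, t.2)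
    & forall (rho : 'X_{1..n}) (t : term n B),
        rho != 0%MM -> prec t ((rho + t.1)%MM, t.2)].

Section LeadingTerms.
Variables (K : fieldType) (n : nat) (B : finType) (prec : rel (term n B)).
Implicit Types f g : freemod K n B.

(* For a strict total order [prec], this is [None] only if f = 0. *)
Definition lead f : option (term n B) :=
  ohead [seq t <- term_supp f
        | all (fun s => (s == t) || prec s t) (term_supp f)].

Definition lead_exp f : 'X_{1..n} := if lead f is Some t then t.1 else 0%MM.

Definition lead_cls f : nat := cls (lead_exp f).

(* The P-ordering. Members of a Pommaret basis that it leaves unordered have
   the same leading exponent, hence leading terms in distinct components; how
   they are numbered is then irrelevant for the Schreyer order below. *)
Definition P_before f g : bool :=
  (lead_cls f < lead_cls g)%N ||
  ((lead_cls f == lead_cls g) &&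
   [exists j : 'I_n, (lead_exp f j < lead_exp g j)%N &&
      [forall i : 'I_n, (j < i)%N ==> (lead_exp f i == lead_exp g i)]]).

Definition pommaret_cone (s t : term n B) : Prop :=
  exists2 rho : 'X_{1..n}, upto (cls s.1) rho & t = ((s.1 + rho)%MM, s.2).

Definition in_cone f (t : term n B) : Prop :=
  exists2 s, lead f = Some s & pommaret_cone s t.

Definition pommaret_basis (N : freemod K n B -> Prop) (I : finType)
    (g : I -> freemod K n B) : Prop :=
  [/\ forall a, g a != 0 /\ N (g a),
      injective (fun a => lead (g a)),
      forall t, (exists2 f, N f & lead f = Some t) <->
                (exists a, in_cone (g a) t)
    & forall t a b, in_cone (g a) t -> in_cone (g b) t -> a = b].

(* f = \sum_a c_a g_a with c_a in K[x_1, .., x_(cls g_a)] *)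
Definition involutive_rep (I : finType) (g : I -> freemod K n B) f
    (c : freemod K n I) : Prop :=
  (forall a mu, mu \in msupp (c a : {mpoly K[n]}) ->
     upto (lead_cls (g a)) mu) /\
  f = \sum_(a : I) (c a : {mpoly K[n]}) *: g a.

(* The order induced by [prec] and the family g on the terms x^mu e_a. *)
Definition schreyer (I : finType) (g : I -> freemod K n B) :
    rel (term n I) :=
  fun s t =>
    match lead (('X_[s.1] : {mpoly K[n]}) *: g s.2),
          lead (('X_[t.1] : {mpoly K[n]}) *: g t.2) with
    | Some u, Some v =>
        prec u v || ((u == v) && P_before (g t.2) (g s.2))
    | _, _ => false
    end.

End LeadingTerms.

(* One map e_a |-> [gen a] between free modules with bases [src] and [tgt],
   together with a term order on the target. *)
Record stage (K : fieldType) (n : nat) := Stage {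
  tgt : finType;
  src : finType;
  ord : rel (term n tgt);
  gen : src -> freemod K n tgt
}.

Section Resolution.
Variables (K : fieldType) (n : nat).

(* Pairs (a, k) where x_k is non-multiplicative for [gen a]. *)
Definition next_src (R : stage K n) : finType :=
  {x : src R * 'I_n | (lead_cls (@ord _ _ R) (gen x.1) < x.2.+1)%N}.

(* x_k e_a - \sum_b c_b e_b, where x_k g_a = \sum_b c_b g_b is the unique
   involutive representation; the vector c is itself \sum_b c_b e_b. *)
Definition next_gen (R : stage K n) (x : next_src R) : freemod K n (src R) :=
  let: (a, k) := val x in
  mterm K (U_(k)%MM, a) -
  epsilon (inhabits 0)
    (involutive_rep (@ord _ _ R) (@gen _ _ R)
       (('X_k : {mpoly K[n]}) *: gen a)).

Definition next_stage (R : stage K n) : stage K n :=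
  Stage (schreyer (@ord _ _ R) (@gen _ _ R)) (@next_gen R).

(* Stage 0 is P^{r_0} -> P^m, e_a |-> h_a. The basis of the source of stage i
   consists of the iterated pairs ((a, k_1), .., k_i), where each k_j exceeds
   the class of the generator indexed by the preceding entries; this class is
   cls h_a for j = 1 and k_(j-1) for j > 1, so that these are the e_(a;k) with
   cls h_a < k_1 < .. < k_i <= n. For large i there are none. *)
Definition syzygy_resolution (m p : nat) (prec : rel (term n 'I_m))
    (h : 'I_p -> term n 'I_m) (i : nat) : stage K n :=
  iter i next_stage (Stage prec (fun a => mterm K (h a))).

(* Stage 0 is the augmentation and does not count. *)
Definition minimal_resolution (C : nat -> stage K n) : Prop :=
  forall i : nat, (0 < i)%N ->
  forall (a : src (C i)) (b : tgt (C i)) (c : K),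
    c != 0 -> gen a b != c%:MP.

Definition generated_by (B : finType) (T : term n B -> Prop)
    (f : freemod K n B) : Prop :=
  exists2 s : seq ({mpoly K[n]} * term n B),
    (forall x, x \in s -> T x.2)
    & f = \sum_(x <- s) x.1 *: mterm K x.2.

Definition monomial_submodule (B : finType) (M : freemod K n B -> Prop) :
    Prop :=
  exists T : term n B -> Prop, forall f, M f <-> generated_by T f.

Definition stable_set (N : 'X_{1..n} -> Prop) : Prop :=
  forall nu, N nu -> forall k j : 'I_n, k.+1 = cls nu -> (k < j)%N ->
    N (nu - U_(k) + U_(j))%MM.

Definition stable (B : finType) (M : freemod K n B -> Prop) : Prop :=
  forall b : B, stable_set (fun mu => M (mterm K (mu, b))).

End Resolution.

(* Main.v *)
(* Write g_1, g_2, .. for the Pommaret basis at some stage. By the division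
   algorithm every element of the submodule has an involutive representation;
   there the leading terms of the summands x^mu g_b are distinct, so that the one
   of x_k g_a is attained exactly once, by a generator that comes later than g_a in
   the P-ordering. Hence S_(a;k) = x_k e_a - \sum_b c_b e_b has leading term x_k e_a.
   The same comparison shows that no syzygy has a leading term x^mu e_a with x^mu
   multiplicative for g_a, and so the S_(a;k) form a Pommaret basis of the syzygies.

   If the S_(a;k) have no constant terms, then neither have the syzygies of the next
   stage, as one sees from the linear terms x_k e_a. So the resolution is minimal if
   and only if the first syzygies have no constant entries. For monomials this
   means that no product x_k h_a with x_k non-multiplicative is again in the Pommaret
   basis, which is a reformulation of stability. *)

Require Import Defs.
From mathcomp Require Import all_boot all_order all_algebra.
From mathcomp Require Import mpoly.
From mathcomp Require Import zify.
From Stdlib Require Import Classical ClassicalEpsilon.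

Set Implicit Arguments.
Unset Strict Implicit.
Unset Printing Implicit Defensive.
Import GRing.Theory.
Local Open Scope ring_scope.

(** * Term orders *)

(* Induction on the number k of coordinates that are compared: elements whose next
   coordinate is below those of the members of the list for k coordinates lie in finitely
   many slices, to each of which the induction hypothesis applies. *)
Lemma dickson_coords n k (A : 'X_{1..n} -> Prop) :
  exists2 F : seq 'X_{1..n}, (forall y, y \in F -> A y) &
    forall x, A x -> exists2 y, y \in F &
      forall i : 'I_n, (i < k)%N -> (y i <= x i)%N.
Proof.
elim: k A => [|k IHk] A.
  case: (classic (exists x, A x)) => [[x Ax]|nA].
    by exists [:: x] => [y /[!inE] /eqP -> //|z _]; exists x; rewrite ?inE.
  by exists [::] => // x Ax; case: nA; exists x.
case: (leqP n k) => [le_nk|lt_kn].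
  have [F FA FP] := IHk A; exists F => // x /FP[y yF le_yx].
  by exists y => // i _; apply: le_yx; apply: leq_trans le_nk.
pose o := Ordinal lt_kn.
have [F FA FP] := IHk A.
have bounded N : exists2 G : seq 'X_{1..n}, (forall y, y \in G -> A y) &
    forall x, A x -> (x o < N)%N -> exists2 y, y \in G &
      forall i : 'I_n, (i < k.+1)%N -> (y i <= x i)%N.
  elim: N => [|N [G GA GP]]; first by exists [::].
  have [G' G'A G'P] := IHk (fun x => A x /\ x o = N).
  exists (G ++ G') => [y|x Ax]; rewrite ?mem_cat.
    by case/orP=> [/GA //|/G'A []].
  rewrite ltnS leq_eqVlt => /orP[/eqP xN|lt_xN].
    have [y yG' le_yx] := G'P x (conj Ax xN); have [_ yN] := G'A y yG'.
    exists y; first by rewrite mem_cat yG' orbT.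
    move=> i; rewrite ltnS leq_eqVlt => /orP[/eqP ik|]; last exact: le_yx.
    by have -> : i = o by [apply: val_inj]; rewrite xN yN.
  by have [y yG le_yx] := GP x Ax lt_xN; exists y; rewrite ?mem_cat ?yG.
have [G GA GP] := bounded (\max_(y <- F) y o).
exists (F ++ G) => [y|x Ax]; first by rewrite mem_cat => /orP[/FA|/GA].
case: (ltnP (x o) (\max_(y <- F) y o)) => [/(GP x Ax)[y yG le_yx]|le_x].
  by exists y; rewrite ?mem_cat ?yG ?orbT.
have [y yF le_yx] := FP x Ax; exists y; first by rewrite mem_cat yF.
move=> i; rewrite ltnS leq_eqVlt => /orP[/eqP ik|]; last exact: le_yx.
have -> : i = o by apply: val_inj.
by apply: leq_trans le_x; apply: (@leq_bigmax_seq _ F xpredT (fun y : 'X_{1..n} => y o)).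
Qed.

Lemma dickson n (A : 'X_{1..n} -> Prop) :
  exists2 F : seq 'X_{1..n}, (forall y, y \in F -> A y) &
    forall x, A x -> exists2 y, y \in F & (y <= x)%MM.
Proof.
have [F FA FP] := dickson_coords n A; exists F => // x /FP[y yF le_yx].
by exists y => //; apply/mnm_lepP => i; apply: le_yx.
Qed.

Lemma seq_min_ex (T : eqType) (r : rel T) (s : seq T) x :
  transitive r -> (forall y z, y != z -> r y z || r z y) ->
  exists2 y, y \in x :: s & forall z, z \in x :: s -> z = y \/ r y z.
Proof.
move=> r_trans r_total; elim: s x => [|a s IHs] x.
  by exists x => [|z]; rewrite ?inE // => /eqP ->; left.
have [y ys yP] := IHs a.
have [->|neq] := eqVneq x y.
  exists y; first by rewrite inE eqxx.
  by move=> z; rewrite inE => /orP[/eqP|/yP]; [left|].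
case/orP: (r_total _ _ neq) => [xy|yx].
  exists x; first by rewrite inE eqxx.
  move=> z; rewrite inE => /orP[/eqP|/yP]; [by left|move=> H; right].
  by case: H => [->|/(r_trans _ _ _ xy)].
exists y; first by rewrite inE ys orbT.
by move=> z; rewrite inE => /orP[/eqP ->|/yP]; [right|].
Qed.

Section TermOrder.
Variables (n : nat) (B : finType) (prec : rel (term n B)).
Hypothesis precP : term_order prec.

Lemma prec_irr t : prec t t = false. Proof. by case: precP. Qed.
Lemma prec_trans : transitive prec. Proof. by case: precP. Qed.
Lemma prec_total s t : s != t -> prec s t || prec t s.
Proof. by case: precP => _ _ + _ _; apply. Qed.

Lemma prec_asym s t : prec s t -> prec t s = false.
Proof.
move=> st; apply/negP => ts; have := prec_irr s.
by rewrite (prec_trans st ts).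
Qed.

Lemma prec_le rho (t : term n B) :
  t = ((rho + t.1)%MM, t.2) \/ prec t ((rho + t.1)%MM, t.2).
Proof.
have [->|nz] := eqVneq rho 0%MM; first by left; rewrite add0m; case: t.
by right; case: precP => _ _ _ _; apply.
Qed.

(** Dickson's lemma in each component leaves a finite part F of A such that every term of A is a
    multiple of a member of F. A multiple is never smaller, so a minimum of F is minimal in A. *)
Lemma prec_min_ex (A : term n B -> Prop) : (exists t, A t) ->
  exists2 t, A t & forall s, A s -> prec s t = false.
Proof.
case=> t0 At0.
have [F FA FP] : exists2 F : seq (term n B), (forall y, y \in F -> A y) &
    forall b x, b \in enum B -> A (x, b) ->
      exists2 y, (y, b) \in F & (y <= x)%MM.
  elim: (enum B) => [|b e [F FA FP]]; first by exists [::].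
  have [G GA GP] := dickson (fun x => A (x, b)).
  exists ([seq (y, b) | y <- G] ++ F) => [y|c x].
    by rewrite mem_cat => /orP[/mapP[z /GA Az ->]|/FA].
  rewrite inE => /orP[/eqP -> /GP[y yG le_yx]|ce /(FP c x ce)[y yF le_yx]].
    by exists y => //; rewrite mem_cat map_f.
  by exists y => //; rewrite mem_cat yF orbT.
case: F => [|y F] in FA FP.
  case: t0 At0 => x b /FP; rewrite mem_enum => /(_ isT)[y].
  by rewrite in_nil.
have [t tF tP] := seq_min_ex F y prec_trans prec_total; exists t; first exact: FA.
case=> x b /FP; rewrite mem_enum => /(_ isT)[z zF le_zx].
have tle : (x, b) = t \/ prec t (x, b).
  have -> : (x, b) = ((x - z + (z, b).1)%MM, (z, b).2) by rewrite /= submK.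
  have := prec_le (x - z)%MM (z, b).
  by case: (tP _ zF) => [->|tz] [<-|zx]; auto; right; apply: prec_trans zx.
by case: tle => [->|/prec_asym]; rewrite ?prec_irr.
Qed.

Lemma prec_wf : well_founded prec.
Proof.
move=> t; apply: NNPP => nt.
have [|s ns smin] := @prec_min_ex (fun t => ~ Acc prec t); first by exists t.
apply: ns; constructor => u us; apply: NNPP => nu.
by rewrite (smin u nu) in us.
Qed.

End TermOrder.

(** * Coefficients and leading terms *)

Lemma mcoeffXM (K : fieldType) n (m k : 'X_{1..n}) (q : {mpoly K[n]}) :
  ('X_[m] * q)@_k = if (m <= k)%MM then q@_(k - m) else 0.
Proof.
case: ifPn => [le_mk|nle].
  by rewrite -{1}(submK le_mk) addmC mulrC mcoeffMX.
apply/memN_msupp_eq0/negP; rewrite mulrC (perm_mem (msuppMX q m)).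
by case/mapP=> x _ kE; rewrite kE lem_addr in nle.
Qed.

Definition fcoef (K : fieldType) n (B : finType) (f : freemod K n B)
    (t : term n B) : K := (f t.2 : {mpoly K[n]})@_t.1.

Section Coefficients.
Variables (K : fieldType) (n : nat).

Section OneModule.
Variable B : finType.
Implicit Types (f g : freemod K n B) (t : term n B).

Lemma freemodP f g : (forall t, fcoef f t = fcoef g t) -> f = g.
Proof. by move=> fg; apply/ffunP => b; apply/mpolyP => mu; apply: (fg (mu, b)). Qed.

Lemma fcoef0 t : fcoef (0 : freemod K n B) t = 0.
Proof. by rewrite /fcoef ffunE mcoeff0. Qed.

Lemma fcoefD f g t : fcoef (f + g) t = fcoef f t + fcoef g t.
Proof. by rewrite /fcoef ffunE mcoeffD. Qed.

Lemma fcoefB f g t : fcoef (f - g) t = fcoef f t - fcoef g t.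
Proof. by rewrite /fcoef !ffunE mcoeffB. Qed.

Lemma fcoefC (c : K) f t : fcoef (c%:MP *: f) t = c * fcoef f t.
Proof. by rewrite /fcoef ffunE; apply: mcoeffCM. Qed.

Lemma fcoef_sum (I : Type) (r : seq I) (F : I -> freemod K n B) t :
  fcoef (\sum_(i <- r) F i) t = \sum_(i <- r) fcoef (F i) t.
Proof.
elim: r => [|i r IHr]; first by rewrite !big_nil fcoef0.
by rewrite !big_cons fcoefD IHr.
Qed.

Lemma fcoefX mu f t :
  fcoef (('X_[mu] : {mpoly K[n]}) *: f) t =
  if (mu <= t.1)%MM then fcoef f ((t.1 - mu)%MM, t.2) else 0.
Proof. by rewrite /fcoef ffunE; apply: mcoeffXM. Qed.

Lemma fcoefXD mu f t :
  fcoef (('X_[mu] : {mpoly K[n]}) *: f) ((mu + t.1)%MM, t.2) = fcoef f t.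
Proof. by rewrite fcoefX /= lem_addr addmC addmK; case: t. Qed.

Lemma fcoefX_neq0 mu f t :
  fcoef (('X_[mu] : {mpoly K[n]}) *: f) t != 0 ->
  exists2 s, fcoef f s != 0 & t = ((mu + s.1)%MM, s.2).
Proof.
rewrite fcoefX; case: ifP => [le_mu|_ /eqP //] nz.
by exists ((t.1 - mu)%MM, t.2) => //=; rewrite addmC submK //; case: t {le_mu nz}.
Qed.

Lemma fcoef_mterm s t : fcoef (mterm K s) t = (s == t)%:R.
Proof.
rewrite /fcoef /mterm ffunE; case: s t => [s a] [t b] /=; rewrite xpair_eqE.
by rewrite (eq_sym a); case: eqP => _; rewrite ?andbT ?andbF ?mcoeffX ?mcoeff0.
Qed.

Lemma mem_term_supp f t : (t \in term_supp f) = (fcoef f t != 0).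
Proof.
rewrite /fcoef -mcoeff_msupp; apply/allpairsPdep/idP => [[b [mu [_ mub ->]]] //|].
by case: t => mu b mub; exists b, mu; rewrite mem_enum.
Qed.

End OneModule.

Lemma scaleX_mterm (B : finType) mu (t : term n B) :
  ('X_[mu] : {mpoly K[n]}) *: mterm K t = mterm K ((mu + t.1)%MM, t.2).
Proof.
apply: freemodP => s; rewrite fcoefX !fcoef_mterm.
case: t s => [t a] [s b] /=; rewrite !xpair_eqE.
case: ifP => [le_mu|]; first by rewrite -{2}(submK le_mu) addmC eqm_add2r.
move=> nle; case: eqP => //= sE.
by rewrite -sE lem_addr in nle.
Qed.

(** The module map sending each [e_a] to [g a]; its kernel is the syzygy module. *)
Definition comb (B I : finType) (g : I -> freemod K n B) (c : freemod K n I) :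
  freemod K n B := \sum_(a : I) (c a : {mpoly K[n]}) *: g a.

Section Comb.
Variables (B I : finType) (g : I -> freemod K n B).
Implicit Types c d : freemod K n I.

Lemma combB c d : comb g (c - d) = comb g c - comb g d.
Proof. by rewrite /comb -sumrB; apply: eq_bigr => a _; rewrite !ffunE scalerBl. Qed.

Lemma combD c d : comb g (c + d) = comb g c + comb g d.
Proof. by rewrite /comb -big_split; apply: eq_bigr => a _; rewrite !ffunE scalerDl. Qed.

Lemma combZ (p : {mpoly K[n]}) c : comb g (p *: c) = p *: comb g c.
Proof. by rewrite /comb scaler_sumr; apply: eq_bigr => a _; rewrite ffunE scalerA. Qed.

Lemma comb_mterm mu a : comb g (mterm K (mu, a)) = ('X_[mu] : {mpoly K[n]}) *: g a.
Proof.
rewrite /comb (bigD1 a) //= big1 ?addr0 => [|b nba]; rewrite ffunE /=.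
  by rewrite eqxx.
by rewrite (negbTE nba) scale0r.
Qed.

Lemma fcoef_comb c t : fcoef (comb g c) t =
  \sum_(a : I) \sum_(mu <- msupp (c a : {mpoly K[n]}))
     fcoef c (mu, a) * fcoef (('X_[mu] : {mpoly K[n]}) *: g a) t.
Proof.
rewrite /comb fcoef_sum; apply: eq_bigr => a _.
rewrite {1}[c a : {mpoly K[n]}]mpolyE scaler_suml fcoef_sum; apply: eq_bigr => mu _.
by rewrite -mul_mpolyC -scalerA fcoefC.
Qed.

(** Comparison of coefficients when a single term s of c can contribute to t, so that nothing
    cancels there. *)
Lemma fcoef_comb1 c t s :
  (forall u, fcoef c u != 0 -> u != s ->
     fcoef (('X_[u.1] : {mpoly K[n]}) *: g u.2) t = 0) ->
  fcoef (comb g c) t =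
  fcoef c s * fcoef (('X_[s.1] : {mpoly K[n]}) *: g s.2) t.
Proof.
case: s => mu a /= iso; rewrite fcoef_comb (bigD1 a) //= [X in _ + X]big1 ?addr0.
  have [mua|/negbTE mua] := boolP (mu \in msupp (c a : {mpoly K[n]})).
    rewrite (bigD1_seq mu) ?msupp_uniq //= big_seq_cond big1 ?addr0 // => nu.
    rewrite mcoeff_msupp => /andP[nz neq].
    by rewrite (iso (nu, a)) ?mulr0 // xpair_eqE (negbTE neq).
  have -> : fcoef c (mu, a) = 0 by apply/eqP; rewrite mcoeff_eq0 mua.
  rewrite mul0r big_seq big1 // => nu; rewrite mcoeff_msupp => nz.
  rewrite (iso (nu, a)) ?mulr0 // xpair_eqE; apply/negP => /andP[/eqP numu _].
  by rewrite -mcoeff_msupp numu mua in nz.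
move=> b neq; rewrite big_seq big1 // => nu; rewrite mcoeff_msupp => nz.
by rewrite (iso (nu, b)) ?mulr0 // xpair_eqE (negbTE neq) andbF.
Qed.

Lemma fcoef_comb0 c t :
  (forall u, fcoef c u != 0 -> fcoef (('X_[u.1] : {mpoly K[n]}) *: g u.2) t = 0) ->
  fcoef (comb g c) t = 0.
Proof.
move=> iso; rewrite fcoef_comb big1 // => b _.
rewrite big_seq big1 // => nu; rewrite mcoeff_msupp => nz.
by rewrite (iso (nu, b)) ?mulr0.
Qed.

End Comb.
End Coefficients.

Section Lead.
Variables (K : fieldType) (n : nat) (B : finType) (prec : rel (term n B)).
Hypothesis precP : term_order prec.
Implicit Types (f g : freemod K n B) (t : term n B).

(** The filtered list in [lead] holds the maxima of the support. By asymmetry any two of them are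
    equal, so it is immaterial which one [ohead] picks. *)
Lemma leadP f t : lead prec f = Some t <->
  fcoef f t != 0 /\ forall s, fcoef f s != 0 -> s = t \/ prec s t.
Proof.
have maxP u : u \in [seq t <- term_supp f |
    all (fun s => (s == t) || prec s t) (term_supp f)] <->
    fcoef f u != 0 /\ forall s, fcoef f s != 0 -> s = u \/ prec s u.
  rewrite mem_filter mem_term_supp; split => [/andP[/allP mx nz]|[nz mx]].
    by split=> // s; rewrite -mem_term_supp => /mx /orP[/eqP|]; auto.
  rewrite nz andbT; apply/allP => s; rewrite mem_term_supp => /mx.
  by case=> [->|->]; rewrite ?eqxx ?orbT.
rewrite /lead; case: filter maxP => [|a l] /= maxP.
  by split=> // /maxP; rewrite in_nil.
have /maxP[nza mxa] : a \in a :: l by rewrite inE eqxx.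
split=> [[<-] //|[nzt mxt]]; congr Some.
case: (mxa t nzt) => [//|ta]; case: (mxt a nza) => [//|at_].
by rewrite (prec_asym precP ta) in at_.
Qed.

Lemma lead_coef_neq0 f t : lead prec f = Some t -> fcoef f t != 0.
Proof. by case/leadP. Qed.

Lemma lead_max f t s : lead prec f = Some t -> fcoef f s != 0 ->
  s = t \/ prec s t.
Proof. by case/leadP=> _; apply. Qed.

Lemma leadNone f : lead prec f = None -> f = 0.
Proof.
rewrite /lead => Enone; apply: freemodP => t; rewrite fcoef0; apply/eqP/negPn/negP => nzt.
have [t0 nz0 mx] : exists2 t, fcoef f t != 0 & forall s, fcoef f s != 0 -> s = t \/ prec s t.
  have : t \in term_supp f by rewrite mem_term_supp.
  case Es : (term_supp f) => [|a l] // _; 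
  (* The order is reversed, so that the minimum found is the largest term of the support. *)
  have [|u w|v vl vP] := @seq_min_ex _ (fun s t => prec t s) l a.
  - by move=> u v w vu wu; apply: prec_trans vu.
  - by rewrite orbC; apply: prec_total.
  by exists v => [|s]; rewrite -mem_term_supp Es //; apply: vP.
have := (leadP f t0).2 (conj nz0 mx); by rewrite /lead Enone.
Qed.

Lemma lead_neq0 f t : lead prec f = Some t -> f != 0.
Proof. by move=> /lead_coef_neq0; apply: contraNneq => ->; rewrite fcoef0. Qed.

Lemma lead_mterm t : lead prec (mterm K t) = Some t.
Proof.
apply/leadP; split=> [|s]; rewrite fcoef_mterm ?eqxx ?oner_eq0 //.
by have [->|_] := eqVneq t s; [left|rewrite eqxx].
Qed.

Lemma leadX mu f t : lead prec f = Some t ->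
  lead prec (('X_[mu] : {mpoly K[n]}) *: f) = Some ((mu + t.1)%MM, t.2).
Proof.
move=> ft; apply/leadP; rewrite fcoefXD; split; first exact: lead_coef_neq0.
move=> s /fcoefX_neq0[u nzu ->].
case: (lead_max ft nzu) => [->|ut]; first by left.
by right; case: precP => _ _ _ + _; apply.
Qed.

End Lead.

(** * Classes and the P-ordering *)

Section Classes.
Variable n : nat.
Implicit Types mu nu : 'X_{1..n}.

(** A number bounds a minimum from below iff it bounds all the arguments; the conjunct [c <= n]
    stems from the base value n. *)
Lemma leq_cls c mu : (c <= cls mu)%N =
  (c <= n)%N && [forall j : 'I_n, (mu j != 0%N) ==> (c <= j.+1)%N].
Proof.
rewrite /cls.
have -> : [forall j : 'I_n, (mu j != 0%N) ==> (c <= j.+1)%N] =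
    all (fun j : 'I_n => (mu j != 0%N) ==> (c <= j.+1)%N) (index_enum 'I_n).
  apply/forallP/allP => mx j; first by move=> _; apply: mx.
  by apply: mx; rewrite mem_index_enum.
elim: (index_enum 'I_n) => [|j s IHs]; first by rewrite big_nil andbT.
rewrite big_cons /=; case: (mu j != 0%N) => //=.
by rewrite leq_min IHs andbCA.
Qed.

Lemma cls_leqn mu : (cls mu <= n)%N.
Proof. by have := leqnn (cls mu); rewrite {1}leq_cls => /andP[]. Qed.

Lemma cls_min mu (j : 'I_n) : mu j != 0%N -> (cls mu <= j.+1)%N.
Proof.
move=> nz; have := leqnn (cls mu).
by rewrite {1}leq_cls => /andP[_ /forallP/(_ j)/implyP]; apply.
Qed.

Lemma cls_eq0 mu (j : 'I_n) : (j.+1 < cls mu)%N -> mu j = 0%N.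
Proof. by move=> lt_j; apply/eqP; apply: contraLR lt_j => /cls_min; rewrite -leqNgt. Qed.

Lemma leq_clsP c mu : (c <= n)%N -> (forall j : 'I_n, mu j != 0%N -> (c <= j.+1)%N) ->
  (c <= cls mu)%N.
Proof. by move=> cn mx; rewrite leq_cls cn; apply/forallP => j; apply/implyP/mx. Qed.

Lemma cls_var mu : (cls mu < n)%N -> exists2 k : 'I_n, k.+1 = cls mu & mu k != 0%N.
Proof.
move=> lt_n; apply: NNPP => none.
suff : (cls mu < cls mu)%N by rewrite ltnn.
apply: leq_clsP => // j nz; rewrite ltn_neqAle cls_min // andbT.
by apply/eqP => jE; apply: none; exists j.
Qed.

Lemma cls_antimono mu nu : (mu <= nu)%MM -> (cls nu <= cls mu)%N.
Proof.
move=> /mnm_lepP le; apply: leq_clsP => [|j nz]; first exact: cls_leqn.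
by apply: cls_min; have := le j; lia.
Qed.

Lemma cls1 (k : 'I_n) : cls U_(k)%MM = k.+1.
Proof.
apply/eqP; rewrite eqn_leq cls_min ?mnm1E ?eqxx //=.
by apply: leq_clsP => // j; rewrite mnm1E; have [->|_] := eqVneq k j.
Qed.

Lemma not_upto1 (k : 'I_n) c : (c < k.+1)%N -> ~ upto c U_(k)%MM.
Proof. by move=> lt_ck /(_ k lt_ck); rewrite mnm1E eqxx. Qed.

(** The P-ordering depends on the leading exponents alone; this is its form on exponents. *)
Definition exp_before mu nu : bool :=
  (cls mu < cls nu)%N || ((cls mu == cls nu) &&
   [exists j : 'I_n, (mu j < nu j)%N &&
      [forall i : 'I_n, (j < i)%N ==> (mu i == nu i)]]).

Lemma exp_beforeP mu nu : exp_before mu nu <->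
  (cls mu < cls nu)%N \/ (cls mu = cls nu /\
   exists j : 'I_n, (mu j < nu j)%N /\ forall i : 'I_n, (j < i)%N -> mu i = nu i).
Proof.
rewrite /exp_before.
split=> [/orP[|/andP[/eqP -> /existsP[j /andP[lt /forallP eqs]]]]|]; first by left.
  by right; split=> //; exists j; split=> // i ij; apply/eqP; have := eqs i; rewrite ij.
case=> [-> //|[-> [j [lt eqs]]]].
rewrite eqxx ltnn; apply/existsP; exists j; rewrite lt; apply/forallP => i.
by apply/implyP => /eqs ->.
Qed.

Lemma exp_before_irr mu : exp_before mu mu = false.
Proof.
apply/negP => /exp_beforeP[|[_ [j []]]]; by rewrite ltnn.
Qed.

Lemma exp_before_trans : transitive exp_before.
Proof.
move=> nu mu rho /exp_beforeP mn /exp_beforeP nr; apply/exp_beforeP.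
case: mn nr => [lt1|[e1 [j [lt1 eq1]]]] [lt2|[e2 [k [lt2 eq2]]]].
- by left; lia.
- by left; lia.
- by left; lia.
right; split; first by rewrite e1.
case: (ltngtP j k) => [jk|kj|/val_inj jk].
- exists k; split=> [|i ki]; first by rewrite eq1.
  by rewrite eq1 ?eq2 //; apply: ltn_trans ki.
- exists j; split=> [|i ji]; first by rewrite -eq2.
  by rewrite eq1 ?eq2 //; apply: ltn_trans ji.
- rewrite -{}jk in lt2 eq2; exists j; split=> [|i ji]; first by lia.
  by rewrite eq1 ?eq2.
Qed.

Lemma exp_before_total mu nu : mu != nu -> exp_before mu nu || exp_before nu mu.
Proof.
move=> neq; have [lt|lt|ecls] := ltngtP (cls mu) (cls nu).
- by rewrite /exp_before lt.
- by rewrite orbC /exp_before lt.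
have [j0 nj0] : exists j, mu j != nu j.
  apply: NNPP => none; case/eqP: neq; apply/mnmP => j.
  by apply/eqP/negPn/negP => nj; apply: none; exists j.
(* The last coordinate where the exponents differ decides. *)
case: (arg_maxnP (P := fun j => mu j != nu j) (fun j : 'I_n => j : nat) nj0) => j nj mx.
have eqs (i : 'I_n) : (j < i)%N -> mu i = nu i.
  by move=> ji; apply/eqP; apply: contraLR ji => /mx; rewrite -leqNgt.
have [lt|gt] : (mu j < nu j)%N \/ (nu j < mu j)%N by lia.
  by apply/orP; left; apply/exp_beforeP; right; split=> //; exists j.
apply/orP; right; apply/exp_beforeP; right; split=> //; exists j; split=> // i ji.
by rewrite eqs.
Qed.

Lemma exp_before_asym mu nu : exp_before mu nu -> exp_before nu mu = false.
Proof.
move=> mn; apply/negP => nm; have := exp_before_irr mu.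
by rewrite (exp_before_trans mn nm).
Qed.

End Classes.

(** * Pommaret bases *)

Definition submodule (K : fieldType) n (B : finType) (N : freemod K n B -> Prop) :=
  (forall f g, N f -> N g -> N (f - g)) /\
  (forall (p : {mpoly K[n]}) f, N f -> N (p *: f)).

Section Pommaret.
Variables (K : fieldType) (n : nat) (B I : finType) (prec : rel (term n B)).
Variables (N : freemod K n B -> Prop) (g : I -> freemod K n B).
Hypothesis precP : term_order prec.
Hypothesis NP : submodule N.
Hypothesis gP : pommaret_basis prec N g.

Lemma lead_gen_ex a : exists t, lead prec (g a) = Some t.
Proof.
Proof.
case: gP => /(_ a)[nz _] _ _ _.
case E : (lead prec (g a)) => [t|]; first by exists t.
by rewrite (leadNone precP E) eqxx in nz.
Qed.

Definition lterm a : term n B := sval (constructive_indefinite_description _ (lead_gen_ex a)).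

Lemma lead_gen a : lead prec (g a) = Some (lterm a).
Proof. by rewrite /lterm; case: constructive_indefinite_description. Qed.

Lemma lead_cls_gen a : lead_cls prec (g a) = cls (lterm a).1.
Proof. by rewrite /lead_cls /lead_exp lead_gen. Qed.

Lemma P_before_gen a b : P_before prec (g a) (g b) = exp_before (lterm a).1 (lterm b).1.
Proof. by rewrite /P_before /lead_cls /lead_exp !lead_gen. Qed.

(* The leading term of x^mu g_a, for s = (mu, a). *)
Definition shift (s : term n I) : term n B := ((s.1 + (lterm s.2).1)%MM, (lterm s.2).2).

Definition mult_term (s : term n I) := upto (cls (lterm s.2).1) s.1.

Lemma lead_shift s : lead prec (('X_[s.1] : {mpoly K[n]}) *: g s.2) = Some (shift s).
Proof. exact/leadX/lead_gen. Qed.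

Lemma gen_mem a : N (g a). Proof. by case: gP => /(_ a)[]. Qed.

Lemma in_coneP a t : in_cone prec (g a) t <->
  exists2 rho, mult_term (rho, a) & t = shift (rho, a).
Proof.
split=> [[s]|[rho up ->]].
  by rewrite lead_gen => -[<-] [rho up ->]; exists rho; rewrite // /shift addmC.
exists (lterm a); first exact: lead_gen.
by exists rho => //; rewrite /shift /= addmC.
Qed.

(** Disjointness of the cones fixes the generator, and cancellation then fixes the cofactor. Hence
    the leading terms of the summands of an involutive representation are pairwise distinct. *)
Lemma shift_inj_mult s t : mult_term s -> mult_term t -> shift s = shift t -> s = t.
Proof.
case: s t => [mu a] [nu b] ms mt est; have ab : a = b.
  case: gP => _ _ _; apply; last by apply/in_coneP; exists nu; first exact: mt.
  by apply/in_coneP; exists mu; first exact: ms.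
by rewrite -{}ab in est *; have /= /addIm -> := congr1 fst est.
Qed.

Lemma shift_inj_gen s t : s.2 = t.2 -> shift s = shift t -> s = t.
Proof.
by case: s t => [mu a] [nu b] /= -> /(congr1 fst) /= /addIm ->.
Qed.

Lemma lterm_inj : injective lterm.
Proof.
move=> a b ltab; case: gP => _ + _ _; apply.
by rewrite !lead_gen ltab.
Qed.

Lemma lead_cover f t : N f -> lead prec f = Some t ->
  exists2 s, mult_term s & t = shift s.
Proof.
move=> Nf ft; case: gP => _ _ /(_ t)[+ _] _ => -[|a]; first by exists f.
by case/in_coneP => rho; exists (rho, a).
Qed.

(* If h_b divides h_a and cls h_a = k < cls h_b, then h_b divides h_a / x_k as well,
   so that h_a lies in the cone of another generator. *)
Lemma before_of_cone s t : mult_term s -> shift s = shift t -> s != t ->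
  exp_before (lterm t.2).1 (lterm s.2).1.
Proof.
case: s t => [rho a] [nu b] ms est neq.
have nab : a != b by apply: contra neq => /eqP ab; apply/eqP/shift_inj_gen.
have eB : (lterm a).2 = (lterm b).2 by exact: (congr1 snd est).
have /mnmP eM : (rho + (lterm a).1 = nu + (lterm b).1)%MM by exact: (congr1 fst est).
have nlt : (lterm b).1 != (lterm a).1.
  apply: contra nab => /eqP ltE; apply/eqP/lterm_inj.
  by move: eB ltE; case: (lterm a) => [? ?]; case: (lterm b) => [? ?] /= -> ->.
case/orP: (exp_before_total nlt) => // /exp_beforeP /=.
move: ms; rewrite /mult_term /= => ms.
set A := (lterm a).1 in eM ms *; set C := (lterm b).1 in eM *.
have leCA (j : 'I_n) : (cls A < j.+1)%N -> (C j <= A j)%N.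
  by move=> /ms rho0; have := eM j; rewrite !mnmDE rho0; lia.
case=> [ltc|[eqc [j [ltj eqs]]]].
  have [k kA Ak] := cls_var (leq_trans ltc (cls_leqn C)).
  have leC : (C <= A - U_(k))%MM.
    apply/mnm_lepP => j; rewrite mnmBE mnm1E.
    have [jA|jA] := leqP j.+1 (cls A).
      by rewrite cls_eq0 // (leq_ltn_trans jA ltc).
    have -> : (k == j) = false by apply/eqP => kj; rewrite kj in kA; lia.
    by rewrite subn0 leCA.
  pose f : freemod K n B := ('X_[(A - U_(k) - C)%MM] : {mpoly K[n]}) *: g b.
  have Nf : N f by apply: (NP.2); apply: gen_mem.
  have [[r c] mr] := lead_cover Nf (lead_shift ((A - U_(k) - C)%MM, b)).
  rewrite /shift /= submK // => e.
  have /= /mnmP er := congr1 fst e; have /= ebc := congr1 snd e.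
  have clsc : (cls A <= cls (lterm c).1)%N.
    by apply: cls_antimono; apply/mnm_lepP => j; have := er j; rewrite mnmDE mnmBE; lia.
  have est' : shift (0%MM, a) = shift ((r + U_(k))%MM, c).
    congr pair => /=; last by rewrite eB.
    apply/mnmP => j; have := er j; rewrite !mnmDE mnmBE mnm0E mnm1E -/A.
    by case: eqP => [<-|_]; lia.
  have m0 : mult_term (0%MM, a) by move=> j _; rewrite mnm0E.
  have mc : mult_term ((r + U_(k))%MM, c).
    move=> j /= clt; rewrite mnmDE (mr j) // mnm1E.
    by case: eqP => // kj; rewrite -kj in clt; lia.
  have /= /mnmP/(_ k) := congr1 fst (shift_inj_mult m0 mc est').
  by rewrite mnmDE mnm1E mnm0E eqxx; lia.
(* Equal classes: outside the multiplicative variables C does not exceed A, so the deciding variable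
   is the class variable. Then h_b is h_a times a power of it and lies in the cone of h_a, against
   disjointness. *)
have jc : j.+1 = cls A.
  have [/ms rj|le1] := ltnP (cls A) j.+1.
    by have := eM j; rewrite !mnmDE rj; lia.
  by apply/eqP; rewrite eqn_leq le1 eqc cls_min //; lia.
have leAC : (A <= C)%MM.
  apply/mnm_lepP => i; have [ij|ij|/val_inj ->] := ltngtP i j; last by lia.
    by rewrite cls_eq0 // -jc.
  by rewrite eqs.
case/eqP: nab.
suff [_ //] : ((C - A)%MM, a) = (0%MM, b).
apply: shift_inj_mult => [i /=|i _|].
- by rewrite -/A -jc ltnS => ji; rewrite mnmBE eqs ?subnn.
- by rewrite mnm0E.
- by rewrite /shift /= submK // add0m eB.
Qed.

(** * Involutive representations and the division algorithm *)

Definition mult_vec (c : freemod K n I) := forall s, fcoef c s != 0 -> mult_term s.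

Lemma involutive_repP f c :
  involutive_rep prec g f c <-> mult_vec c /\ f = comb g c.
Proof.
split=> -[mc ->]; split=> //.
  by case=> mu a nz; rewrite /mult_term -lead_cls_gen; apply: mc; rewrite mcoeff_msupp.
move=> a mu; rewrite mcoeff_msupp lead_cls_gen => nz.
exact: (mc (mu, a)).
Qed.

(** The leading term of f lies in some cone; subtracting a scalar multiple of the corresponding
    [x^r g_a] cancels it and leaves only smaller terms. This stops because term orders are
    well-founded. *)
Lemma involutive_rep_ex f : N f -> exists c, involutive_rep prec g f c.
Proof.
have rep0 : exists c, involutive_rep prec g 0 c.
  exists 0; apply/involutive_repP; split=> [s|]; first by rewrite fcoef0 eqxx.
  by rewrite /comb big1 // => a _; rewrite ffunE scale0r.
move=> Nf; case ft : (lead prec f) => [t|]; last by rewrite (leadNone precP ft).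
elim/(well_founded_ind (prec_wf precP)): t f ft Nf => t IHt f ft Nf.
have [[r a] mr tE] := lead_cover Nf ft.
have xg := lead_shift (r, a); rewrite -tE /= in xg.
pose q : freemod K n B := ('X_[r] : {mpoly K[n]}) *: g a.
pose al := fcoef f t / fcoef q t.
pose f' := f - al%:MP *: q.
have [c' rep'] : exists c, involutive_rep prec g f' c.
  case f't' : (lead prec f') => [t'|]; last by rewrite (leadNone precP f't').
  apply: (IHt t') => //; last first.
    by apply: (NP.1) => //; apply: (NP.2); apply: (NP.2); apply: gen_mem.
  have nz := lead_coef_neq0 precP f't'.
  have neq : t' != t.
    apply: contra nz => /eqP ->; rewrite fcoefB fcoefC divfK ?subrr //.
    exact: lead_coef_neq0 xg.
  case: (eqVneq (fcoef f t') 0) => [ft'0|nzf].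
    have nzq : fcoef q t' != 0.
      by apply: contra nz => /eqP qt'0; rewrite fcoefB fcoefC ft'0 qt'0 mulr0 subr0.
    by case: (lead_max precP xg nzq) => // tt'; rewrite tt' eqxx in neq.
  by case: (lead_max precP ft nzf) => // tt'; rewrite tt' eqxx in neq.
case/involutive_repP: rep' => mc' f'E.
exists (c' + al%:MP *: mterm K (r, a)); apply/involutive_repP; split=> [s|].
  rewrite fcoefD fcoefC fcoef_mterm; have [<- //|_] := eqVneq (r, a) s.
  by rewrite mulr0 addr0; apply: mc'.
by rewrite combD combZ comb_mterm -f'E /f' subrK.
Qed.

(** * Syzygies *)

Local Notation S := (schreyer prec g).

Lemma schreyerE s t : S s t = prec (shift s) (shift t) ||
  ((shift s == shift t) && exp_before (lterm t.2).1 (lterm s.2).1).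
Proof. by rewrite /schreyer !lead_shift P_before_gen. Qed.

Lemma schreyer_term_order : term_order S.
Proof.
have shiftD rho s : shift ((rho + s.1)%MM, s.2) = ((rho + (shift s).1)%MM, (shift s).2).
  by rewrite /shift /= addmA.
split.
- by move=> s; rewrite schreyerE (prec_irr precP) exp_before_irr andbF.
- move=> t s u; rewrite !schreyerE.
  case/orP=> [st|/andP[/eqP -> b1]] /orP[tu|/andP[/eqP tuE b2]].
  + by rewrite (prec_trans precP st tu).
  + by rewrite -tuE st.
  + by rewrite tu.
  + by rewrite tuE eqxx (exp_before_trans b2 b1) orbT.
- move=> s t neq; rewrite !schreyerE.
  have [e|ne] := eqVneq (shift s) (shift t); last first.
    by case/orP: (prec_total precP ne) => ->; rewrite ?orbT.
  rewrite e (prec_irr precP) /= orbC; apply: exp_before_total.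
  (* Equal images lie in the same component; if the leading exponents agree too, so do the leading
     terms of the generators. Hence the pairs left open by the P-ordering cause no ties. *)
  apply: contra neq => /eqP ee; apply/eqP/shift_inj_gen => //; apply: lterm_inj.
  by move: e ee => [_]; case: (lterm s.2) => ? ?; case: (lterm t.2) => ? ? /= -> ->.
- move=> rho s t; rewrite !schreyerE !shiftD => /orP[st|/andP[/eqP e b]].
    by case: precP => _ _ _ /(_ rho _ _ st) -> _.
  by rewrite e eqxx orbC b.
- move=> rho t nz; rewrite schreyerE shiftD.
  by case: precP => _ _ _ _ ->.
Qed.

Let SP := schreyer_term_order.

(** The Schreyer order compares images first, so every other term of c has a strictly smaller image
    and the top one cannot cancel. *)
Lemma lead_comb c s : lead S c = Some s ->
  (forall u, fcoef c u != 0 -> shift u = shift s -> u = s) ->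
  lead prec (comb g c) = Some (shift s).
Proof.
move=> cs uniq; have below u : fcoef c u != 0 -> u = s \/ prec (shift u) (shift s).
  move=> nzu; case: (lead_max SP cs nzu) => [|us]; [by left|right].
  have := us; rewrite schreyerE => /orP[//|/andP[/eqP /(uniq u nzu) e _]].
  by rewrite e (prec_irr SP) in us.
apply/(leadP precP); split.
  rewrite (@fcoef_comb1 _ _ _ _ g c _ s) => [|u nzu neq].
    by rewrite mulf_neq0 ?(lead_coef_neq0 SP cs) ?(lead_coef_neq0 precP (lead_shift s)).
  apply/eqP/negPn/negP => nz.
  case: (below u nzu) => [us|us]; first by rewrite us eqxx in neq.
  case: (lead_max precP (lead_shift u) nz) => [e|su].
    by rewrite e (prec_irr precP) in us.
  by rewrite (prec_asym precP su) in us.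
move=> t nzt; apply: NNPP => bad; case/eqP: nzt; apply: fcoef_comb0 => u nzu.
apply/eqP/negPn/negP => nz; apply: bad.
have tu := lead_max precP (lead_shift u) nz.
case: (below u nzu) => [<- //|us]; right.
by case: tu => [-> //|tu]; apply: prec_trans us.
Qed.

Lemma lead_comb_mult c s : mult_vec c -> lead S c = Some s ->
  lead prec (comb g c) = Some (shift s).
Proof.
move=> mc cs; apply: lead_comb => // u nzu; apply: shift_inj_mult; first exact: mc.
exact/mc/(lead_coef_neq0 SP cs).
Qed.

(** If the leading term s were multiplicative, any other term with the same image would belong to an
    earlier generator and so be larger in the Schreyer order. Thus s alone has its image, and the
    combination is non-zero. *)
Lemma lead_syzygy c s : comb g c = 0 -> lead S c = Some s -> ~ mult_term s.
Proof.
move=> c0 cs ms; suff : lead prec (comb g c) = Some (shift s).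
  by move=> /(lead_neq0 precP); rewrite c0 eqxx.
apply: lead_comb => // u nzu e; apply: NNPP => neq.
have := before_of_cone ms (esym e); case: eqVneq => [su|_ /(_ isT) b].
  by case: neq.
case: (lead_max SP cs nzu) => //.
by rewrite schreyerE e (prec_irr precP) (exp_before_asym b) andbF.
Qed.

Lemma lead_next a (k : 'I_n) c : ~ mult_term (U_(k)%MM, a) ->
  involutive_rep prec g (('X_k : {mpoly K[n]}) *: g a) c ->
  lead S (mterm K (U_(k)%MM, a) - c) = Some (U_(k)%MM, a).
Proof.
move=> nm /involutive_repP[mc xgE]; set t := (U_(k)%MM, a).
have below u : fcoef c u != 0 -> S u t.
  move=> nzu; case cs : (lead S c) => [s|]; last first.
    by move: nzu; rewrite (leadNone SP cs) fcoef0 eqxx.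
  (* The leading term s of c has the same image as [x_k e_a], and its generator comes later in the
     P-ordering, which makes s smaller. *)
  have st : S s t.
    have := lead_comb_mult mc cs; rewrite -xgE (lead_shift t) => /Some_inj e.
    have ms := mc _ (lead_coef_neq0 SP cs).
    rewrite schreyerE -e (prec_irr precP) eqxx /=; apply: (before_of_cone ms (esym e)).
    by apply/eqP => st; rewrite st in ms.
  by case: (lead_max SP cs nzu) => [->|us] //; apply: (prec_trans SP us).
apply/(leadP SP); rewrite fcoefB fcoef_mterm eqxx; split.
  have -> : fcoef c t = 0.
    by apply/eqP/negPn/negP => /below; rewrite (prec_irr SP).
  by rewrite subr0 oner_eq0.
move=> s; rewrite fcoefB fcoef_mterm; case: (eqVneq t s) => [->|_]; first by left.
by rewrite sub0r oppr_eq0 => /below; right.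
Qed.

End Pommaret.

(** * The syzygy resolution *)

Section Stages.
Variables (K : fieldType) (n : nat).
Implicit Types R : stage K n.

(** The invariant carried along the resolution. The submodule is existential because it changes with
    the stage: M at first, then kernels. *)
Definition pommaret_stage R := term_order (@ord _ _ R) /\
  exists2 N, submodule N & pommaret_basis (@ord _ _ R) N (@gen _ _ R).

(** The division algorithm supplies a representation, so that the [epsilon] in [next_gen] really
    picks one. *)
Lemma next_genP R (x : next_src R) : pommaret_stage R ->
  exists2 c, involutive_rep (@ord _ _ R) (@gen _ _ R)
      (('X_(val x).2 : {mpoly K[n]}) *: gen (val x).1) c
    & next_gen x = mterm K (U_((val x).2)%MM, (val x).1) - c.
Proof.
case=> oP [N NP gP]; rewrite /next_gen; case: x => [[a k] /= _].
exists (epsilon (inhabits 0)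
    (involutive_rep (@ord _ _ R) (@gen _ _ R)
       (('X_k : {mpoly K[n]}) *: gen a))) => //.
apply: epsilon_spec; apply: (involutive_rep_ex oP NP gP); apply: (NP.2).
exact: gen_mem gP _.
Qed.

Lemma lead_next_gen R (x : next_src R) : pommaret_stage R ->
  lead (schreyer (@ord _ _ R) (@gen _ _ R)) (next_gen x) =
  Some (U_((val x).2)%MM, (val x).1).
Proof.
move=> RP; have [c crep ->] := next_genP x RP; case: RP => oP [N NP gP].
have nm : ~ mult_term oP gP (U_((val x).2)%MM, (val x).1).
  rewrite /mult_term /=; apply: not_upto1; rewrite -(lead_cls_gen oP gP).
  by case: (x).
exact: (lead_next NP nm crep).
Qed.

Lemma next_src_eq R (x y : next_src R) :
  (val x).2 = (val y).2 -> (val x).1 = (val y).1 -> x = y.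
Proof.
by move=> e2 e1; apply/val_inj; case: (val x) (val y) e1 e2 => [? ?] [? ?] /= -> ->.
Qed.

Lemma mnm1_inj (i j : 'I_n) : U_(i)%MM = U_(j)%MM -> i = j.
Proof. by move/eqP; rewrite eq_mnm1 => /eqP. Qed.

Lemma pommaret_next R : pommaret_stage R -> pommaret_stage (next_stage R).
Proof.
move=> RP; have [oP [N NP gP]] := RP; set S := schreyer (@ord _ _ R) (@gen _ _ R).
have SP : term_order S := schreyer_term_order oP gP.
(* The leading term [x_k e_a] has class k, so exactly [x_1, .., x_k] are multiplicative; the
   successor accounts for ordinals starting at 0. *)
have coneP (x : next_src R) t : in_cone S (next_gen x) t <->
    exists2 rho, upto (val x).2.+1 rho & t = ((U_((val x).2) + rho)%MM, (val x).1).
  split=> [[s]|[rho up ->]].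
    by rewrite lead_next_gen // => /Some_inj <- [rho]; rewrite cls1 => up ->; exists rho.
  exists (U_((val x).2)%MM, (val x).1); first exact: lead_next_gen.
  by exists rho; rewrite //= cls1.
split=> //; exists (fun c => comb (@gen _ _ R) c = 0).
  split=> [c d c0 d0|p c c0]; first by rewrite combB c0 d0 subr0.
  by rewrite combZ c0 scaler0.
have next_syz (x : next_src R) : comb (@gen _ _ R) (next_gen x) = 0.
  have [c /(involutive_repP oP gP)[_ cE] ->] := next_genP x RP.
  by rewrite combB comb_mterm -cE subrr.
split.
- by move=> x; split; [exact: (lead_neq0 SP (lead_next_gen x RP))|exact: next_syz].
- move=> x y; rewrite !lead_next_gen // => /Some_inj e.
  by apply: next_src_eq; [exact: mnm1_inj (congr1 fst e)|exact: (congr1 snd e)].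
- case=> mu a; split=> [[c c0 cmu]|[x /coneP[rho up tE]]]; last first.
    exists (('X_[rho] : {mpoly K[n]}) *: (next_gen x : freemod K n _)).
      by rewrite combZ next_syz scaler0.
    by rewrite (leadX SP rho (lead_next_gen x RP)) tE addmC.
  have nm : ~ mult_term oP gP (mu, a) by apply: lead_syzygy c0 cmu.
  have [j0 nj0] : exists j : 'I_n, (mu j != 0%N) && (lead_cls (@ord _ _ R) (gen a) < j.+1)%N.
    apply: NNPP => none; apply: nm => j /= lt_j; apply/eqP/negPn/negP => nz.
    by apply: none; exists j; rewrite nz (lead_cls_gen oP gP).
  (* For the largest non-multiplicative variable [x_k] dividing [x^mu], the quotient involves only
     [x_1, .., x_k] and is thus multiplicative for [S_(a;k)]. *)
  case: (arg_maxnP (P := fun j => (mu j != 0%N) && (lead_cls (@ord _ _ R) (gen a) < j.+1)%N)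
    (fun j : 'I_n => j : nat) nj0) => k /andP[nk lt_k] mx.
  exists (exist _ (a, k) lt_k : next_src R); apply/coneP; exists (mu - U_(k))%MM => /=.
    move=> j; rewrite ltnS => kj; rewrite mnmBE.
    suff -> : mu j = 0%N by [].
    apply/eqP; apply: contraLR kj => nj; rewrite -leqNgt; have [//|kj] := leqP j k.
    by have /= := mx j; rewrite nj (leq_trans lt_k (leqW kj)) leqNgt kj => /(_ isT).
  rewrite addmC submK //; apply/mnm_lepP => j; rewrite mnm1E.
  by have [<-|//] := eqVneq k j; rewrite lt0n.
- move=> t x y /coneP[r upr ->] /coneP[s ups] e.
  apply: next_src_eq; last exact: (congr1 snd e).
  have /mnmP eM := congr1 fst e; rewrite /= in eM.
  apply: val_inj => /=; set k := (val x).2 in upr eM *; set l := (val y).2 in ups eM *.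
  (* The larger of the two variables would divide one side but not the other. *)
  case: (ltngtP k l) => // [kl|lk].
    by have := eM l; rewrite !mnmDE !mnm1E eqxx (upr l) ?ltnS // -val_eqE /= ltn_eqF.
  by have := eM k; rewrite !mnmDE !mnm1E eqxx (ups k) ?ltnS // -val_eqE /= ltn_eqF.
Qed.

(** Stronger than the absence of non-zero constant entries: the constant coefficient of every entry
    vanishes. This form passes on to the next stage. *)
Definition const_free R := forall (a : src R) (b : tgt R), fcoef (gen a) (0%MM, b) = 0.

Lemma lep_mnm1 m (k : 'I_n) : (m <= U_(k))%MM -> m = 0%MM \/ m = U_(k)%MM.
Proof.
move=> /mnm_lepP le; case: (eqVneq (m k) 0%N) => mk; [left|right]; apply/mnmP => j;
  have := le j; rewrite ?mnm0E !mnm1E; case: eqP => [<-|]; lia.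
Qed.

(** The terms [x_k e_b] indexed by [next_src] are non-multiplicative, so the subtracted
    representation contains none of them. *)
Lemma fcoef_next_gen R (x y : next_src R) : pommaret_stage R ->
  fcoef (next_gen x) (U_((val y).2)%MM, (val y).1) = (x == y)%:R.
Proof.
move=> RP; have [c crep ->] := next_genP x RP; case: RP => oP [N NP gP].
have [mc _] := (involutive_repP oP gP _ _).1 crep.
rewrite fcoefB [X in _ - X](_ : _ = 0) ?subr0 ?fcoef_mterm.
  congr (nat_of_bool _)%:R; apply/eqP/eqP => [e|-> //].
  by apply: next_src_eq; [exact: mnm1_inj (congr1 fst e)|exact: (congr1 snd e)].
apply/eqP/negPn/negP => /mc; rewrite /mult_term /=; apply: not_upto1.
by rewrite -(lead_cls_gen oP gP); case: (y).
Qed.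

(* In x_l S_a = \sum_b c_b S_b, the linear term x_k e_b' occurs on the right-hand side with
   coefficient c_(b';k)(0), because x_k is non-multiplicative for b', and on
   the left-hand side with coefficient 0, because S_a has no constant terms. *)
Lemma const_free_next R : pommaret_stage R -> const_free (next_stage R) ->
  const_free (next_stage (next_stage R)).
Proof.
move=> RP free x b'; have R'P := pommaret_next RP.
have [c crep] := next_genP x R'P.
case: R'P => oP' [N' NP' gP'].
have [mc cE] := (involutive_repP oP' gP' _ _).1 crep.
move: cE => {mc crep}; move: (val x) => [b l] /= cE; rewrite /gen /= => ->.
rewrite fcoefB fcoef_mterm xpair_eqE mnm1_eq0 /= sub0r; apply/eqP; rewrite oppr_eq0.
pose t := (U_((val b').2)%MM, (val b').1).
(* A non-trivial multiplier dividing the linear term t equals its variable and leaves a constant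
   coefficient of [S_y], which is 0. This disposes of the left-hand side and of all non-constant
   terms of c. *)
have lhs0 m (y : next_src R) : m != 0%MM ->
    fcoef (('X_[m] : {mpoly K[n]}) *: (next_gen y : freemod K n (src R))) t = 0.
  move=> nz; rewrite fcoefX /=; case: ifP => // /lep_mnm1[m0|->].
    by rewrite m0 eqxx in nz.
  have -> : (U_((val b').2) - U_((val b').2) = 0)%MM.
    by apply/mnmP => j; rewrite mnmBE subnn mnm0E.
  exact: (free y).
have : fcoef (comb (@next_gen _ _ R) c) t = 0.
  by rewrite -cE lhs0 // mnm1_eq0.
rewrite (@fcoef_comb1 _ _ _ _ _ c t (0%MM, b')) => [|[m y] _ /=].
  by rewrite mpolyX0 scale1r fcoef_next_gen // eqxx mulr1 => ->.
have [->|nz _] := eqVneq m 0%MM; last exact: lhs0.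
rewrite xpair_eqE eqxx /= mpolyX0 scale1r fcoef_next_gen //.
by move/negbTE => ->.
Qed.

End Stages.

(** * Monomial bases: first syzygies, stability and the equivalence *)

Section Monomial.
Variables (K : fieldType) (n m p : nat) (prec : rel (term n 'I_m)).
Variables (M : freemod K n 'I_m -> Prop) (h : 'I_p -> term n 'I_m).
Hypothesis precP : term_order prec.
Hypothesis MP : monomial_submodule M.
Hypothesis hP : pommaret_basis prec M (fun a => mterm K (h a)).

Lemma submodule_of_monomial : submodule M.
Proof.
case: MP => T MT; split=> [f g /MT[s sT ->] /MT[s' s'T ->]|q f /MT[s sT ->]]; apply/MT.
  exists (s ++ [seq (- x.1, x.2) | x <- s']) => [x|].
    by rewrite mem_cat => /orP[/sT //|/mapP[y /s'T Ty ->]].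
  rewrite big_cat big_map -sumrN; congr (_ + _); apply: eq_bigr => x _.
  by rewrite scaleNr.
exists [seq (q * x.1, x.2) | x <- s] => [x /mapP[y /sT Ty -> //]|].
by rewrite big_map scaler_sumr; apply: eq_bigr => x _; rewrite scalerA.
Qed.

Let hshift := shift precP hP.

Lemma lterm_monomial a : lterm precP hP a = h a.
Proof. by apply: Some_inj; rewrite -lead_gen lead_mterm. Qed.

Lemma shift_monomial s : hshift s = ((s.1 + (h s.2).1)%MM, (h s.2).2).
Proof. by rewrite /hshift /shift lterm_monomial. Qed.

Lemma mem_monomial t : M (mterm K t) <-> exists2 s, mult_term precP hP s & t = hshift s.
Proof.
split=> [Mt|[s _ ->]]; first by apply: lead_cover Mt _; apply: lead_mterm.
rewrite shift_monomial -scaleX_mterm; apply: (submodule_of_monomial.2).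
exact: gen_mem hP _.
Qed.

Lemma mem_monomialM rho t : M (mterm K t) -> M (mterm K ((rho + t.1)%MM, t.2)).
Proof. by rewrite -scaleX_mterm; apply: (submodule_of_monomial.2). Qed.

(** For monomial generators each multiplicative term maps to a single term, and distinct ones have
    distinct images. So a term of M is represented by exactly one product, that of the cone
    containing it. *)
Lemma fcoef_monomial_rep t c s :
  mult_vec precP hP c -> mterm K t = comb (fun a => mterm K (h a)) c ->
  mult_term precP hP s -> fcoef c s = (hshift s == t)%:R.
Proof.
move=> mc tE ms; have := congr1 (fun f => fcoef f (hshift s)) tE.
rewrite fcoef_mterm (@fcoef_comb1 _ _ _ _ _ c (hshift s) s) => [|u nzu neq].
  by rewrite scaleX_mterm fcoef_mterm shift_monomial eqxx mulr1 eq_sym => ->.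
rewrite scaleX_mterm fcoef_mterm; case: eqP => // e.
case/eqP: neq; apply: (shift_inj_mult (mc _ nzu) ms).
by rewrite -/hshift shift_monomial e.
Qed.

Let R0 : stage K n := Stage prec (fun a => mterm K (h a)).

Lemma pommaret_base : pommaret_stage R0.
Proof. by split=> //; exists M; [exact: submodule_of_monomial|]. Qed.

(** The link between the two sides of the theorem: equivalent to stability, and to the first
    syzygies having no constant entries. *)
Definition prolong_free := forall a b (k : 'I_n), (cls (h a).1 < k.+1)%N ->
  h b != ((U_(k) + (h a).1)%MM, (h a).2).

Lemma first_rep (x : next_src R0) : exists2 c,
  next_gen x = mterm K (U_((val x).2)%MM, (val x).1) - c &
  mult_vec precP hP c /\
  forall s, mult_term precP hP s ->
    fcoef c s = (hshift s == ((U_((val x).2) + (h (val x).1).1)%MM, (h (val x).1).2))%:R.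
Proof.
have [c /(involutive_repP precP hP)[mc cE] ->] := next_genP x pommaret_base.
exists c => //; split=> // s; apply: fcoef_monomial_rep => //.
by rewrite -cE -scaleX_mterm.
Qed.

Lemma mult0 b : mult_term precP hP (0%MM, b).
Proof. by move=> j _; rewrite mnm0E. Qed.

Lemma shift0 b : hshift (0%MM, b) = h b.
Proof. by rewrite shift_monomial add0m; case: (h b). Qed.

Lemma lead_cls_base a : lead_cls prec (mterm K (h a)) = cls (h a).1.
Proof. by rewrite (lead_cls_gen precP hP) lterm_monomial. Qed.

Lemma prolong_free_const_free : prolong_free -> const_free (next_stage R0).
Proof.
move=> pf x b; have [c xE [mc cE]] := first_rep x.
rewrite /gen /= xE fcoefB fcoef_mterm xpair_eqE mnm1_eq0 /= sub0r cE; last exact: mult0.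
rewrite shift0 (negbTE (pf _ _ _ _)) ?oppr0 // -lead_cls_base.
by case: (x).
Qed.

Lemma const_entry a b (k : 'I_n) :
  (cls (h a).1 < k.+1)%N -> h b = ((U_(k) + (h a).1)%MM, (h a).2) ->
  exists x : src (next_stage R0), gen x b = (-1)%:MP.
Proof.
move=> lt_k hb; have lt_k' : (lead_cls (@ord _ _ R0) (gen (s := R0) a) < k.+1)%N.
  by rewrite /gen /= lead_cls_base.
pose x : next_src R0 := exist _ (a, k) lt_k'; exists x.
have [c xE [mc cE]] := first_rep x.
have -> : gen (s := next_stage R0) x = mterm K (U_(k)%MM, a) - c by [].
(* As [x_k h_a = h_b] lies in the cone of [h_b] with cofactor 1, the syzygy is [x_k e_a - e_b]. *)
have -> : c = (mterm K (0%MM, b) : freemod K n 'I_p).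
  apply: freemodP => s; rewrite fcoef_mterm.
  case: (classic (mult_term precP hP s)) => ms.
    rewrite cE //= -hb -shift0; congr (nat_of_bool _)%:R.
    by apply/eqP/eqP => [/(shift_inj_mult ms (@mult0 b)) -> //|<-].
  case: eqP => [e|_]; first by case: ms; rewrite -e; apply: mult0.
  by apply/eqP/negPn/negP => /mc.
have nab : b != a.
  apply/eqP => ba; have /= /mnmP/(_ k) := congr1 fst hb.
  by rewrite ba mnmDE mnm1E eqxx; lia.
by rewrite !ffunE /= (negbTE nab) eqxx sub0r mpolyX0 mpolyCN mpolyC1.
Qed.

(** Suppose [h_b = x_k h_a] and let [x_j] be the class variable of [h_a]. By stability
    [x_k h_a / x_j] lies in the cone of some [h_c], whose class is at least that of [h_a]. So [x_j]
    is multiplicative for [h_c], and [h_b] lies in its cone with a non-trivial cofactor, against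
    disjointness. *)
Lemma stable_prolong_free : stable M -> prolong_free.
Proof.
move=> st a b k lt_k; apply/eqP => hb.
have Mh c : M (mterm K (h c)) by exact: gen_mem hP c.
have [j jE nj] := cls_var (leq_trans lt_k (ltn_ord k)).
have jk : (j < k)%N by lia.
have := st (h a).2 (h a).1; rewrite -surjective_pairing => /(_ (Mh a) j k jE jk).
set A := (h a).1 in hb lt_k jE nj *.
have eB (i : 'I_n) : (h b).1 i = ((k == i) + A i)%N by rewrite hb mnmDE mnm1E.
case/mem_monomial => [[r c] mr]; rewrite shift_monomial /= => e.
have /= /mnmP er := congr1 fst e; have /= ebc := congr1 snd e.
have clsc : (cls A <= cls (h c).1)%N.
  apply: leq_clsP => [|i nz]; first exact: cls_leqn.
  have := er i; rewrite !mnmDE mnmBE !mnm1E; case: (eqVneq k i) => [<- _|_]; first by lia.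
  by move=> ei; apply: cls_min; lia.
have mrj : mult_term precP hP ((r + U_(j))%MM, c).
  move=> i /= lt_i; rewrite mnmDE (mr i) // mnm1E; move: lt_i; rewrite lterm_monomial.
  by case: eqP => // <-; lia.
have e' : hshift ((r + U_(j))%MM, c) = hshift (0%MM, b).
  rewrite shift0 shift_monomial hb /= -ebc; congr pair.
  apply/mnmP => i; have := er i; rewrite !mnmDE mnmBE !mnm1E.
  by have [<-|_] := eqVneq j i; lia.
have /= /mnmP/(_ j) := congr1 fst (shift_inj_mult mrj (@mult0 b) e').
by rewrite mnmDE mnm1E eqxx mnm0E; lia.
Qed.

Lemma prolong_free_stable : prolong_free -> stable M.
Proof.
move=> pf b nu Mnu k j kE kj.
have nk : nu k != 0%N.
  have lt_n : (cls nu < n)%N by rewrite -kE; apply: leq_ltn_trans kj (ltn_ord j).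
  have [k' k'E] := cls_var lt_n.
  have -> // : k' = k by apply/val_inj/succn_inj; rewrite k'E kE.
(* If [x_k] divides the cofactor, dividing by it stays inside M. This is tried for nu first, then
   for its product with [x_j]. *)
have divk (nu' : 'X_{1..n}) : nu' k != 0%N ->
    (exists2 s : term n 'I_p, s.1 k != 0%N & (nu', b) = hshift s) ->
    M (mterm K ((nu' - U_(k))%MM, b)).
  move=> nk' [[r a] /= rk]; rewrite shift_monomial /= => e.
  have /= er := congr1 fst e; have /= -> := congr1 snd e.
  have -> : (nu' - U_(k) = r - U_(k) + (h a).1)%MM.
    apply/mnmP => i; rewrite er !(mnmBE, mnmDE) mnm1E.
    by have [<-|_] := eqVneq k i; lia.
  by apply: (mem_monomialM (r - U_(k))%MM); apply: gen_mem hP a.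
have swap : (nu - U_(k) + U_(j) = (nu + U_(j)) - U_(k))%MM.
  apply/mnmP => i; rewrite !(mnmBE, mnmDE) !mnm1E.
  by have [<-|_] := eqVneq k i; lia.
have [[r a] mr e] := (mem_monomial _).1 Mnu.
have [rk|rk] := eqVneq (r k) 0%N; last first.
  have := mem_monomialM U_(j)%MM (divk nu nk (ex_intro2 _ _ (r, a) rk e)).
  by rewrite /= addmC.
rewrite shift_monomial /= in e.
have /= /mnmP er := congr1 fst e; have /= eb := congr1 snd e.
have ak : (h a).1 k != 0%N by have := er k; rewrite mnmDE rk; lia.
have clsa := cls_min ak.
(* The variables below [x_k] do not divide [x^nu], those above are non-multiplicative for [h_a], and
   [x_k] is excluded by [rk]; so nu is the exponent of [h_a] itself. *)
have r0 : r = 0%MM.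
  apply/mnmP => i; rewrite mnm0E.
  have [ik|ik|/val_inj -> //] := ltngtP i k.
    have : nu i = 0%N by apply: cls_eq0; rewrite -kE.
    by have := er i; rewrite mnmDE; lia.
  by apply: (mr i); rewrite /= lterm_monomial; lia.
have nuE : nu = (h a).1 by apply/mnmP => i; rewrite er mnmDE r0 mnm0E.
have nj : (nu + U_(j))%MM k != 0%N by rewrite mnmDE; lia.
rewrite swap; apply: divk => //.
have Mj := mem_monomialM U_(j)%MM Mnu; rewrite /= addmC in Mj.
have [[s c] ms e'] := (mem_monomial _).1 Mj; exists (s, c) => //=.
apply/negP => /eqP sk; rewrite shift_monomial /= in e'.
have /= /mnmP es := congr1 fst e'; have /= ec := congr1 snd e'.
have ck : (h c).1 k != 0%N by have := es k; rewrite !mnmDE sk; lia.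
have clsc := cls_min ck.
(* By the same argument [x_j h_a] would be the generator [h_c], which [prolong_free] forbids. *)
have s0 : s = 0%MM.
  apply/mnmP => i; rewrite mnm0E.
  have [ik|ik|/val_inj -> //] := ltngtP i k.
    have nui : nu i = 0%N by apply: cls_eq0; rewrite -kE.
    have := es i; rewrite !mnmDE nui mnm1E; case: eqP => [ji|_]; last by lia.
    by rewrite -ji in ik; lia.
  by apply: (ms i); rewrite /= lterm_monomial; lia.
have := pf a c j; rewrite -nuE -kE ltnS => /(_ kj); case/eqP.
rewrite -eb [h c]surjective_pairing -ec; congr pair.
by apply/mnmP => i; rewrite addmC es s0 mnmDE mnm0E.
Qed.

Lemma minimal_iff_stable : minimal_resolution (syzygy_resolution K prec h) <-> stable M.
Proof.
have pommaret i : pommaret_stage (iter i (@next_stage K n) R0).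
  by elim: i => [|i IHi]; [exact: pommaret_base|exact: pommaret_next].
split=> [min|/stable_prolong_free pf [//|i] _ a b c nz].
  apply: prolong_free_stable => a b k lt_k; apply/eqP => hb.
  have [x xE] := const_entry lt_k hb.
  (* Stage 1 holds the first syzygies, and -1 is a non-zero constant. *)
  by have := min 1%N isT x b (-1); rewrite xE oppr_eq0 oner_eq0 eqxx => /(_ isT).
(* The induction starts at stage 1, since the generators at stage 0 may have constant entries. *)
have free : const_free (iter i.+1 (@next_stage K n) R0).
  elim: i {a b} => [|i IHi]; first exact: prolong_free_const_free.
  exact: (const_free_next (pommaret i) IHi).
apply/eqP => abE; have := free a b; rewrite /fcoef /=.
rewrite [X in X@_0]abE mcoeffC eqxx mulr1 => c0.
by rewrite c0 eqxx in nz.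
Qed.

End Monomial.

Theorem theorem8p6 (K : fieldType) (n m p : nat)
    (prec : rel (term n 'I_m)) (M : freemod K n 'I_m -> Prop)
    (h : 'I_p -> term n 'I_m) :
  term_order prec ->
  monomial_submodule M ->
  pommaret_basis prec M (fun a => mterm K (h a)) ->
  minimal_resolution (syzygy_resolution K prec h) <-> stable M.
Proof. exact: minimal_iff_stable. Qed.
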